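(* Let $k\ge2$ be an integer, and let $\alpha_1,\dots,\alpha_k,\alpha_f$ be real parameters with $\alpha_j\ge1$ for $j=1,\dots,k-1$ and $\alpha_k\ge\alpha_f\ge\frac12$; let $\gamma_j=\alpha_j-\frac12$ for $j=1,\dots,k-1$ and $\gamma_k=\frac12-\alpha_f+\alpha_k$. Then the $k$-equation generalized-$\alpha$ method with these parameters (defined in the context) is A-stable: for every $\theta\in\mathbb{C}$ with $\operatorname{Re}(\theta)\ge0$, every eigenvalue $\tilde\lambda$ of its amplification matrix $G=G(\theta)$ satisfies $|\tilde\lambda|\le1$.
   Context: The method is applied to the scalar test equation $\dot u+\lambda_\theta u=0$ with $\lambda_\theta\in\mathbb{C}$ and step size $\tau>0$; put $\theta=\tau\lambda_\theta$. The unknowns at step $n$ are $W_n^{(0)},\dots,W_n^{(2k-1)}\in\mathbb{C}$, with $W_n^{(i)}$ approximating $u^{(i)}(t_n)$. The unknowns at step $n+1$ are determined as follows. For $j=1,\dots,k-1$, with $Q_{n,j}=W^{(2j-1)}_{n+1}-\sum_{i=0}^{2k-2j}\frac{\tau^i}{i!}W^{(2j-1+i)}_n$, $$\sum_{i=0}^{2k-2j}\frac{\tau^i}{i!}W^{(2j-1+i)}_n+\alpha_jQ_{n,j}=-\lambda_\theta W^{(2j-2)}_{n+1},\qquad W^{(2j-2)}_{n+1}=\sum_{i=0}^{2k-2j+1}\frac{\tau^i}{i!}W^{(2j-2+i)}_n+\tau\gamma_jQ_{n,j},$$ and $$W^{(2k-1)}_n+\alpha_k\big(W^{(2k-1)}_{n+1}-W^{(2k-1)}_n\big)=-\lambda_\theta\big(W^{(2k-2)}_n+\alpha_f(W^{(2k-2)}_{n+1}-W^{(2k-2)}_n)\big),$$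 $$W^{(2k-2)}_{n+1}=W^{(2k-2)}_n+\tau W^{(2k-1)}_n+\tau\gamma_k\big(W^{(2k-1)}_{n+1}-W^{(2k-1)}_n\big).$$ The amplification matrix $G=G(\theta)$ is the $2k\times2k$ matrix with $\mathbf U_{n+1}=G\,\mathbf U_n$, where $\mathbf U_n=(W^{(0)}_n,\tau W^{(1)}_n,\dots,\tau^{2k-1}W^{(2k-1)}_n)^T$. It is block upper triangular with $2\times2$ diagonal blocks $$G_j=\frac{1}{\alpha_j+\gamma_j\theta}\begin{bmatrix}\alpha_j&\alpha_j-\gamma_j\\-\theta&\alpha_j+(\gamma_j-1)\theta-1\end{bmatrix}\ (j=1,\dots,k-1),$$ $$G_k=\frac{1}{\alpha_k+\alpha_f\gamma_k\theta}\begin{bmatrix}\alpha_k+(\alpha_f-1)\gamma_k\theta&\alpha_k-\gamma_k\\-\theta&\alpha_k+\alpha_f(\gamma_k-1)\theta-1\end{bmatrix}.$$ *)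

(* Defs.v *)
From mathcomp Require Import all_boot all_order all_algebra.
From mathcomp Require Import reals.
From mathcomp Require Export complex.
Set Implicit Arguments.
Unset Strict Implicit.
Unset Printing Implicit Defensive.
Import Order.TTheory GRing.Theory Num.Theory.
Local Open Scope ring_scope.
Local Open Scope complex_scope.

(* [W i] stands for the unknown W_n^(i), an approximation of u^(i)(t_n). Only  *)
(* the values at i < 2k occur in the method. Parameter sequences               *)
(* [alpha], [gamma] are indexed from 1; their values outside 1..k never occur. *)

(* \sum_(0 <= i <= m) tau^i / i! * W^(p + i) *)
Definition taylor (R : realType) (tau : R) (W : nat -> R[i]) (p m : nat) : R[i] :=
  \sum_(0 <= i < m.+1) (tau ^+ i / (i`!)%:R)%:C * W (p + i)%N.

(* Q_{n,j}, with W = W_n and W' = W_{n+1} *)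
Definition genalpha_Q (R : realType) (k : nat) (tau : R) (W W' : nat -> R[i])
    (j : nat) : R[i] :=
  W' (2 * j - 1)%N - taylor tau W (2 * j - 1) (2 * k - 2 * j).

(* One step, from W = W_n to W' = W_{n+1}, of the k-equation generalized-alpha *)
(* method for u' + lambda u = 0 with step size tau. *)
Definition genalpha_step (R : realType) (k : nat) (alpha gamma : nat -> R)
    (alphaf tau : R) (lambda : R[i]) (W W' : nat -> R[i]) : Prop :=
  [/\ forall j : nat, (1 <= j <= k - 1)%N ->
        taylor tau W (2 * j - 1) (2 * k - 2 * j)
          + (alpha j)%:C * genalpha_Q k tau W W' j
        = - lambda * W' (2 * j - 2)%N
        /\
        W' (2 * j - 2)%N
        = taylor tau W (2 * j - 2) (2 * k - 2 * j + 1)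
          + tau%:C * (gamma j)%:C * genalpha_Q k tau W W' j,
      W (2 * k - 1)%N + (alpha k)%:C * (W' (2 * k - 1)%N - W (2 * k - 1)%N)
      = - lambda * (W (2 * k - 2)%N
                    + alphaf%:C * (W' (2 * k - 2)%N - W (2 * k - 2)%N))
    & W' (2 * k - 2)%N
      = W (2 * k - 2)%N + tau%:C * W (2 * k - 1)%N
        + tau%:C * (gamma k)%:C * (W' (2 * k - 1)%N - W (2 * k - 1)%N)].

(* U_n = (W_n^(0), tau W_n^(1), ..., tau^(2k-1) W_n^(2k-1))^T *)
Definition genalpha_vec (R : realType) (k : nat) (tau : R) (W : nat -> R[i]) :
    'cV[R[i]]_(2 * k) :=
  \col_(i < 2 * k) ((tau ^+ i)%:C * W i).

(* G = G(theta): for every step size tau > 0 and every lambda with             *)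
(* tau * lambda = theta, the step equations are equivalent to                  *)
(* U_{n+1} = G U_n, i.e. they determine the unknowns at step n+1 through G.    *)
(* At most one matrix G has this property.                                     *)
Definition is_amplification_matrix (R : realType) (k : nat)
    (alpha gamma : nat -> R) (alphaf : R) (theta : R[i])
    (G : 'M[R[i]]_(2 * k)) : Prop :=
  forall (tau : R) (lambda : R[i]), 0 < tau -> theta = tau%:C * lambda ->
  forall W W' : nat -> R[i],
    genalpha_step k alpha gamma alphaf tau lambda W W'
    <-> genalpha_vec k tau W' = G *m genalpha_vec k tau W.

(* [eigenvalue] refers to row eigenvectors, which yields the same eigenvalues. *)
Definition genalpha_A_stable (R : realType) (k : nat) (alpha gamma : nat -> R)
    (alphaf : R) : Prop :=
  forall theta : R[i], 0 <= complex.Re theta ->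
  exists2 G : 'M[R[i]]_(2 * k),
    is_amplification_matrix alpha gamma alphaf theta G
    & forall l : R[i], eigenvalue G l -> `|l| <= 1.

(* Main.v *)
Require Import Defs.
From mathcomp Require Import all_boot all_order all_algebra.
From mathcomp Require Import reals ring lra zify.
Import Order.TTheory GRing.Theory Num.Theory.
Local Open Scope ring_scope.

(** Each of the first [k - 1] pairs of equations is a last pair with [alphaf = 1],
    up to Taylor terms in higher unknowns. On a column eigenvector [v] of [G]
    with eigenvalue [mu], look at the last pair with a nonzero entry: there the
    higher Taylor terms vanish, and the pair satisfies a scalar two-term recurrence.
    With [s = 1 / (mu - 1) + 1 / 2], which has positive real part exactly when
    [1 < |mu|], its characteristic equation reads
    [- theta^-1 = s + b c / (s + b + c)], where [b = alphaf - 1 / 2] and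
    [c = alpha - alphaf] are nonnegative; so [1 < |mu|] forces [Re theta < 0]. *)

Section Stability.
Local Open Scope complex_scope.
Variable R : realType.
Implicit Types (x y z mu theta s : R[i]) (a b c f g : R).

(** * Real and imaginary parts *)

Lemma complexReD x y : complex.Re (x + y) = complex.Re x + complex.Re y.
Proof. by case: x y => [? ?] [? ?]. Qed.

Lemma complexImD x y : complex.Im (x + y) = complex.Im x + complex.Im y.
Proof. by case: x y => [? ?] [? ?]. Qed.

Lemma complexReN x : complex.Re (- x) = - complex.Re x.
Proof. by case: x. Qed.

Lemma complexImN x : complex.Im (- x) = - complex.Im x.
Proof. by case: x. Qed.

Lemma complexReM x y :
  complex.Re (x * y) = complex.Re x * complex.Re y - complex.Im x * complex.Im y.
Proof. by case: x y => [? ?] [? ?]. Qed.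

Lemma complexImM x y :
  complex.Im (x * y) = complex.Re x * complex.Im y + complex.Im x * complex.Re y.
Proof. by case: x y => [? ?] [? ?]. Qed.

Definition complexReIm :=
  (complexReD, complexImD, complexReN, complexImN, complexReM, complexImM).

(** * The eigenvalue bound for a single pair of equations *)

(** Expanding [|1 + z| ^ 2] leaves [0 < |z| ^ 2 + 2 Re z]; dividing by [2 |z| ^ 2] gives the bound,
    since [Re z^-1 = Re z / |z| ^ 2]. *)
Lemma Re_inv_gtNhalf z :
  1 < `|1 + z| -> z != 0 /\ - (1 / 2) < complex.Re z^-1.
Proof.
move=> lt1z; have z0 : z != 0.
  by apply: contraTneq lt1z => ->; rewrite addr0 normr1 ltxx.
split=> //; move: lt1z z0.
rewrite normc_def -(rmorph1 (real_complex R)) ltcR.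
case: z => u v; rewrite eq_complex /= => lt1 uv0.
have {}lt1 : 1 < (1 + u) ^+ 2 + (0 + v) ^+ 2.
  rewrite ltNge; apply: contraTN lt1 => h; rewrite -leNgt.
  by rewrite -[leRHS]sqrtr1 ler_wsqrtr.
have n0 : 0 < u ^+ 2 + v ^+ 2.
  rewrite lt_neqAle addr_ge0 ?sqr_ge0 // andbT eq_sym paddr_eq0 ?sqr_ge0 //.
  by rewrite !sqrf_eq0.
by rewrite ltr_pdivlMr //; nra.
Qed.

(** Put [z = (s + b) (s + c) = s (s + b + c) + b c], multiply an equality by the conjugate of [z]
    and take real parts. The right side becomes [- Re theta |z| ^ 2 <= 0], the left side [|s + b +
    c| ^ 2 Re s + b c Re (s + b + c) > 0]. *)
Lemma right_half_plane_symbol theta s b c :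
  0 <= complex.Re theta -> 0 < complex.Re s -> 0 <= b -> 0 <= c ->
  s + b%:C + c%:C <> - theta * ((s + b%:C) * (s + c%:C)).
Proof.
case: theta s => [tr ti] [sr si] /= tr0 sr0 b0 c0 E.
have := congr1 (@complex.Im R) E; have := congr1 (@complex.Re R) E.
rewrite !complexReIm /= !addr0.
set p := sr + b + c; have p0 : 0 < p by rewrite /p; lra.
set zr := _ - si * si; set zi := _ * si + _ => Er Ei.
have Epz : p * zr + si * zi = - tr * (zr ^+ 2 + zi ^+ 2).
  by rewrite {1}Er {1}Ei; ring.
have : p * zr + si * zi = (p ^+ 2 + si ^+ 2) * sr + b * c * p.
  by rewrite /zr /zi /p; ring.
have : 0 < (p ^+ 2 + si ^+ 2) * sr + b * c * p.
  rewrite ltr_wpDr ?mulr_ge0 ?(ltW p0) // mulr_gt0 // ltr_wpDr ?sqr_ge0 //.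
  by rewrite exprn_gt0.
have : 0 <= tr * (zr ^+ 2 + zi ^+ 2) by rewrite mulr_ge0 ?addr_ge0 ?sqr_ge0.
lra.
Qed.

(** The two equations are those of a step of unit size from [(x, y)] to [mu * (x, y)] when all
    higher unknowns vanish. Multiplied by [w = 1 / (mu - 1)], the second expresses [x] through [y],
    and the first then becomes an equation in [w] alone. *)
Lemma block_eigenvalue_le1 theta mu x y a f :
  0 <= complex.Re theta -> 1 / 2 <= f -> f <= a -> (x != 0) || (y != 0) ->
  y + a%:C * (mu * y - y) = - theta * (x + f%:C * (mu * x - x)) ->
  mu * x = x + y + (1 / 2 - f + a)%:C * (mu * y - y) ->
  `|mu| <= 1.
Proof.
move=> th0 f0 fa xy0 E1 E2; rewrite real_leNgt ?normr_real ?real1 //.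
apply/negP => lt1.
pose d := mu - 1; have Emu : mu = 1 + d by rewrite /d; ring.
have [d0 Rew] := @Re_inv_gtNhalf d (eq_ind mu (fun t => 1 < `|t|) lt1 _ Emu).
set w := d^-1 in Rew; have wd : w * d = 1 by rewrite mulVf.
pose g := 1 / 2 - f + a.
have Ex : x = y * (w + g%:C).
  have : w * (mu * x) = w * (x + y + g%:C * (mu * y - y)) by rewrite -E2.
  rewrite Emu => E.
  have -> : x = w * ((1 + d) * x) - w * x + (1 - w * d) * x by ring.
  rewrite E; transitivity (y * (w + g%:C) + (w * d - 1) * (g%:C * y - x)).
    by ring.
  by rewrite wd; ring.
(* [x] is a multiple of [y], so [y = 0] would make both entries vanish. *)
have y0 : y != 0.
  by apply: contraTneq xy0 => y0; rewrite Ex y0 mul0r eqxx.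
(* The shift turns [- 1 / 2 < Re w] into [0 < Re s]. With [b = f - 1 / 2] and [c = a - f], the value
   of [g] makes [w + f], [w + g], [w + a] equal to [s + b], [s + c], [s + b + c]. *)
pose s := w + (1 / 2)%:C.
have Ew : w + a%:C = - theta * ((w + f%:C) * (w + g%:C)).
  apply: (mulfI y0).
  have -> : y * (w + a%:C) = w * (y + a%:C * (mu * y - y)) + a%:C * y * (1 - w * d).
    by rewrite Emu; ring.
  have -> : y * (- theta * ((w + f%:C) * (w + g%:C))) =
      w * (- theta * (x + f%:C * (mu * x - x))) - theta * f%:C * x * (1 - w * d).
    by rewrite Emu Ex; ring.
  by rewrite wd E1; ring.
apply: (@right_half_plane_symbol theta s (f - 1 / 2) (a - f)) => //.
- by rewrite complexReD /=; lra.
- lra.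
- lra.
have -> : s + (f - 1 / 2)%:C + (a - f)%:C = w + a%:C.
  by rewrite /s !(rmorphD, rmorphB) /=; ring.
have -> : s + (f - 1 / 2)%:C = w + f%:C by rewrite /s !(rmorphD, rmorphB) /=; ring.
have -> : s + (a - f)%:C = w + g%:C by rewrite /s /g !(rmorphD, rmorphB) /=; ring.
exact: Ew.
Qed.

(** * Column eigenvectors, and the step as [k] solvable pairs *)

(** A square matrix and its transpose are singular together. Columns are what the step acts on. *)
Lemma column_eigenvector (F : fieldType) n (A : 'M[F]_n) (l : F) :
  eigenvalue A l -> exists2 v : 'cV[F]_n, A *m v = l *: v & v != 0.
Proof.
rewrite /eigenvalue /eigenspace /= kermx_eq0 row_free_unit -unitmx_tr -row_free_unit.
rewrite -kermx_eq0 => /rowV0Pn[v /sub_kermxP vA v0].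
exists v^T; last by rewrite trmx_eq0.
apply/eqP; rewrite -subr_eq0 -mul_scalar_mx -mulmxBl -trmx_eq0 trmx_mul trmxK.
exact/eqP.
Qed.

(** The real part is [a + f g Re theta >= a]. *)
Lemma block_denominator_neq0 theta a f g :
  0 <= complex.Re theta -> 0 < a -> 0 <= f -> 0 <= g ->
  a%:C + f%:C * g%:C * theta != 0.
Proof.
case: theta => [tr ti] /= tr0 a0 f0 g0.
rewrite eq_complex negb_and; apply/orP; left.
rewrite !complexReIm /= !(mul0r, mulr0, subr0, addr0).
by rewrite gt_eqF // ltr_wpDr // !mulr_ge0.
Qed.

(** Eliminating [x'] by the second equation leaves a linear equation for [y'] with leading
    coefficient [a + f * g * theta]. *)
Lemma block_solve (F : fieldType) (a f g theta x t0 t1 x' y' : F) :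
  a + f * g * theta != 0 ->
  let d := (a + f * g * theta)^-1 in
  let ys := d * (- theta * f * t0 + (a - 1 + theta * f * g) * t1
                 - theta * (1 - f) * x) in
  (t1 + a * (y' - t1) = - theta * (x + f * (x' - x)) /\
   x' = t0 + g * (y' - t1)) <->
  (x' = t0 - g * t1 + g * ys /\ y' = ys).
Proof.
move=> D0 d ys; rewrite /ys /d; split=> [[E1 E2]|[-> ->]]; last by split; field.
suff Ey : y' = ys by rewrite -/ys -Ey; split=> //; rewrite E2; ring.
apply: (mulfI D0); rewrite /ys mulrA mulfV // mul1r.
have -> : (a + f * g * theta) * y' =
  (t1 + a * (y' - t1)) + theta * f * g * y' + a * t1 - t1 by ring.
by rewrite E1 E2; ring.
Qed.

(* The pair with index [j + 1] of the paper, counting from [j = 0]. *)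
Definition alphaf_of k f j : R := if j.+1 == k then f else 1.

(** For [j.+1 < k] the factor 1 collapses [W + (W' - W)] to [W']; for [j.+1 = k] the Taylor sums
    have degrees 1 and 0, which gives the last two equations. *)
Lemma genalpha_stepE k (alpha gamma : nat -> R) f (tau : R) (lambda : R[i])
    (W W' : nat -> R[i]) : (0 < k)%N ->
  genalpha_step k alpha gamma f tau lambda W W' <->
  forall j, (j < k)%N ->
    let t0 := taylor tau W (2 * j) (2 * k - 2 * j - 1) in
    let t1 := taylor tau W (2 * j).+1 (2 * k - 2 * j - 2) in
    let q := W' (2 * j).+1 - t1 in
    let fj := alphaf_of k f j in
    t1 + (alpha j.+1)%:C * q
      = - lambda * (W (2 * j)%N + fj%:C * (W' (2 * j)%N - W (2 * j)%N)) /\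
    W' (2 * j)%N = t0 + tau%:C * (gamma j.+1)%:C * q.
Proof.
move=> k0.
have taylor1 p : taylor tau W p 1 = W p + tau%:C * W p.+1.
  by rewrite /taylor !big_nat_recr //= big_nil add0r !divr1 expr0 mul1r addn0 addn1.
have taylor0 p : taylor tau W p 0 = W p.
  by rewrite /taylor big_nat1 expr0 divr1 mul1r addn0.
have idx j : (j < k)%N -> [/\ (2 * j.+1 - 1 = (2 * j).+1)%N,
    (2 * j.+1 - 2 = 2 * j)%N, (2 * k - 2 * j.+1 = 2 * k - 2 * j - 2)%N
    & (2 * k - 2 * j.+1 + 1 = 2 * k - 2 * j - 1)%N].
  by move=> jk; split; lia.
have [e1 e2 _ _] := idx k.-1 ltac:(lia).
have Ek : k.-1.+1 = k by lia.
rewrite Ek in e1 e2.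
have e3 : (2 * k - 2 * k.-1 - 1 = 1)%N by lia.
have e4 : (2 * k - 2 * k.-1 - 2 = 0)%N by lia.
split=> [[H1 H2 H3] j jk|H].
  rewrite /alphaf_of; case: eqP => [jk1|njk].
    have -> : j = k.-1 by lia.
    by rewrite e3 e4 taylor1 taylor0 Ek /= -e1 -e2; split.
  have := H1 j.+1 ltac:(lia); have [i1 i2 i3 i4] := idx j jk.
  rewrite /genalpha_Q i4 i1 i2 i3 => -[-> ->]; split=> //.
  by rewrite mul1r subrKC.
have := H k.-1 ltac:(lia).
rewrite /alphaf_of Ek eqxx e3 e4 taylor1 taylor0 /= => -[Hk1 Hk2].
split; rewrite ?e1 ?e2 // => -[//|j] /andP[_ jk].
have := H j ltac:(lia); have [i1 i2 i3 i4] := idx j ltac:(lia).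
rewrite /genalpha_Q i4 i1 i2 i3 /alphaf_of ifN; last by apply/eqP; lia.
by rewrite /= mul1r subrKC.
Qed.

(** * The amplification matrix *)

(** Coefficients of a Taylor sum in the scaled unknowns [tau ^+ l * W l]; the scaling absorbs every
    power of [tau], so they do not depend on the step size. *)
Definition taylor_coef (p l : nat) : R[i] :=
  if (p <= l)%N then ((l - p)`!%:R^-1)%:C else 0.

(** The hypothesis says that the Taylor sum ends exactly at the last unknown, of index [2 * k - 1];
    the indices below [p] contribute zero. *)
Lemma scaled_taylor k (tau : R) (W : nat -> R[i]) p m :
  (p + m.+1 = 2 * k)%N ->
  (tau ^+ p)%:C * taylor tau W p m =
  \sum_(l < 2 * k) taylor_coef p l * ((tau ^+ l)%:C * W l).
Proof.
move=> pm.
rewrite -(big_mkord xpredT (fun l => taylor_coef p l * ((tau ^+ l)%:C * W l))).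
rewrite (@big_cat_nat _ _ _ p) //=; last by lia.
rewrite big_nat_cond big1 ?add0r; last first.
  by move=> l; rewrite andbT => /andP[_ lp]; rewrite /taylor_coef leqNgt lp mul0r.
rewrite -{3}[p]add0n big_addn -pm addKn /taylor mulr_sumr.
apply: eq_bigr => l _; rewrite /taylor_coef leq_addl addnK addnC exprD !rmorphM /=.
by ring.
Qed.

(** The solution found in [block_solve], with [b] selecting [y']. Being linear in [(t0, t1, x)], it
    serves both for matrix entries and for values of unknowns. *)
Definition block_update (b : bool) (a f g theta t0 t1 x : R[i]) : R[i] :=
  let ys := (a + f * g * theta)^-1 *
    (- theta * f * t0 + (a - 1 + theta * f * g) * t1 - theta * (1 - f) * x) in
  if b then ys else t0 - g * t1 + g * ys.

Lemma block_update_sum n (b : bool) (a f g theta : R[i]) (t0 t1 x V : 'I_n -> R[i]) :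
  \sum_l block_update b a f g theta (t0 l) (t1 l) (x l) * V l =
  block_update b a f g theta (\sum_l t0 l * V l) (\sum_l t1 l * V l)
    (\sum_l x l * V l).
Proof.
(* The coefficients of the linear form are its values at the unit vectors. *)
have [A [B [C uE]]] : exists A B C, forall r0 r1 r2,
    block_update b a f g theta r0 r1 r2 = A * r0 + B * r1 + C * r2.
  exists (block_update b a f g theta 1 0 0), (block_update b a f g theta 0 1 0),
    (block_update b a f g theta 0 0 1) => r0 r1 r2.
  by rewrite /block_update; case: b; ring.
rewrite uE !mulr_sumr -!big_split /=; apply: eq_bigr => l _.
by rewrite uE; ring.
Qed.

Section Amplification.
Variables (k : nat) (alpha gamma : nat -> R) (f : R) (theta : R[i]).

(** Row [i] belongs to the pair [i./2], its parity choosing the unknown. The update formula is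
    applied to the coefficient rows of the two Taylor sums and of the old value. *)
Definition amplification_mx : 'M[R[i]]_(2 * k) :=
  \matrix_(i, l) let j := i./2 in
    block_update (odd i) (alpha j.+1)%:C (alphaf_of k f j)%:C (gamma j.+1)%:C
      theta (taylor_coef (2 * j) l) (taylor_coef (2 * j).+1 l)
      (l == 2 * j :> nat)%N%:R.

(** By linearity, [G] times the scaled vector is the update formula applied to scaled Taylor sums.
    The step equations match it after scaling the first of each pair by [tau ^+ (2 * j).+1] and the
    second by [tau ^+ (2 * j)], which is reversible. *)
Lemma amplification_mxP :
  (0 < k)%N ->
  (forall j, (j < k)%N ->
     (alpha j.+1)%:C + (alphaf_of k f j)%:C * (gamma j.+1)%:C * theta != 0) ->
  is_amplification_matrix alpha gamma f theta amplification_mx.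
Proof.
move=> k0 D0 tau lambda tau0 Eth W W'.
have tauC0 : tau%:C != 0 by rewrite (fmorph_eq0 (real_complex R)) gt_eqF.
pose V n := (tau ^+ n)%:C * W n; pose V' n := (tau ^+ n)%:C * W' n.
pose T p := \sum_(l < 2 * k) taylor_coef p l * V l.
pose update (b : bool) (j : nat) := block_update b (alpha j.+1)%:C (alphaf_of k f j)%:C
  (gamma j.+1)%:C theta (T (2 * j)%N) (T (2 * j).+1) (V (2 * j)%N).
have GE (i : 'I_(2 * k)) :
    (amplification_mx *m genalpha_vec k tau W) i 0 = update (odd i) i./2.
  have ilt : (2 * i./2 < 2 * k)%N by have := ltn_ord i; lia.
  rewrite mxE; under eq_bigr => l _ do rewrite !mxE.
  rewrite block_update_sum /update; congr (block_update _ _ _ _ _ _ _ _).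
  rewrite (bigD1 (Ordinal ilt)) //= eqxx mul1r big1 ?addr0 // => l.
  by rewrite -val_eqE /= => /negbTE ->; rewrite mul0r.
have vecE : genalpha_vec k tau W' = amplification_mx *m genalpha_vec k tau W <->
    forall j, (j < k)%N ->
      V' (2 * j)%N = update false j /\ V' (2 * j).+1 = update true j.
  move: update GE => update GE; split=> [E j jk|H].
    have lt0 : (2 * j < 2 * k)%N by lia.
    have lt1 : ((2 * j).+1 < 2 * k)%N by lia.
    have := congr1 (fun M : 'cV_(2 * k) => M (Ordinal lt0) 0) E.
    have := congr1 (fun M : 'cV_(2 * k) => M (Ordinal lt1) 0) E.
    by rewrite !GE !mxE /= mul2n odd_double /= uphalf_double doubleK.
  apply/colP => i; rewrite GE mxE; move: (nat_of_ord i) (ltn_ord i) => n nk.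
  have := H n./2 ltac:(lia); rewrite !mul2n.
  have En := odd_double_half n; rewrite /V' => -[].
  by case: (odd n) En => /=; rewrite ?add0n ?add1n => ->.
rewrite vecE genalpha_stepE //.
suff blockE j : (j < k)%N ->
    (let t0 := taylor tau W (2 * j) (2 * k - 2 * j - 1) in
    let t1 := taylor tau W (2 * j).+1 (2 * k - 2 * j - 2) in
    let q := W' (2 * j).+1 - t1 in
    let fj := alphaf_of k f j in
    t1 + (alpha j.+1)%:C * q
      = - lambda * (W (2 * j)%N + fj%:C * (W' (2 * j)%N - W (2 * j)%N)) /\
    W' (2 * j)%N = t0 + tau%:C * (gamma j.+1)%:C * q) <->
    V' (2 * j)%N = update false j /\ V' (2 * j).+1 = update true j.
  by split=> H j jk; apply/(blockE j jk)/H.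
move=> jk; apply: iff_trans (block_solve _ _ _ _ _ _ _ _ _ _ (D0 j jk)) => /=.
have -> : T (2 * j)%N =
    (tau ^+ (2 * j))%:C * taylor tau W (2 * j) (2 * k - 2 * j - 1).
  by rewrite (@scaled_taylor k) //; lia.
have -> : T (2 * j).+1 =
    (tau ^+ (2 * j).+1)%:C * taylor tau W (2 * j).+1 (2 * k - 2 * j - 2).
  by rewrite (@scaled_taylor k) //; lia.
rewrite /V /V' Eth exprS rmorphM /=.
set t0 := taylor _ _ (2 * j)%N _; set t1 := taylor _ _ _ _.
set c := (tau ^+ (2 * j))%:C.
have c0 : c != 0 by rewrite (fmorph_eq0 (real_complex R)) expf_neq0 // gt_eqF.
split=> [[E1 E2]|[E1 E2]]; split.
- transitivity (tau%:C * c * (t1 + (alpha j.+1)%:C * (W' (2 * j).+1 - t1))).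
    by ring.
  by rewrite E1; ring.
- by rewrite {1}E2; ring.
(* Conversely, the nonzero scaling factors are cancelled. *)
- apply: (mulfI (mulf_neq0 tauC0 c0)).
  transitivity (tau%:C * c * t1 + (alpha j.+1)%:C *
    (tau%:C * c * W' (2 * j).+1 - tau%:C * c * t1)); first by ring.
  by rewrite E1; ring.
- by apply: (mulfI c0); rewrite E2; ring.
Qed.

(** * Eigenvalues of the amplification matrix *)

(** Only the defining property of [G] enters, at [tau = 1] and [lambda = theta]: an eigenvector
    provides unknowns [W] for which [l * W] is the next step. *)
Lemma amplification_eigenvalue_le1 (G : 'M[R[i]]_(2 * k)) l :
  (0 < k)%N -> 0 <= complex.Re theta ->
  (forall j, (j < k)%N -> let fj := alphaf_of k f j in
     [/\ 1 / 2 <= fj, fj <= alpha j.+1 & gamma j.+1 = 1 / 2 - fj + alpha j.+1]) ->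
  is_amplification_matrix alpha gamma f theta G -> eigenvalue G l -> `|l| <= 1.
Proof.
move=> k0 th0 par ampG /column_eigenvector[v Gv v0].
(* The default 0 lets the vanishing beyond the last nonzero entry hold at every index. *)
pose W n := if insub n is Some i then v i 0 else 0.
have Wv (i : 'I_(2 * k)) : W i = v i 0 by rewrite /W valK.
have /(ampG 1 theta ltr01 (esym (mul1r _)) W (fun n => l * W n)) :
    genalpha_vec k 1 (fun n => l * W n) = G *m genalpha_vec k 1 W.
  have -> : genalpha_vec k 1 W = v.
    by apply/colP => i; rewrite mxE expr1n mul1r Wv.
  by rewrite Gv; apply/colP => i; rewrite !mxE expr1n mul1r Wv.
rewrite genalpha_stepE // => step.
have /cV0Pn[i0 vi0] := v0.
case: (@arg_maxnP _ i0 (fun i => v i 0 != 0) val vi0) => i vi imax.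
have Wgt n : (i < n)%N -> W n = 0.
  move=> ltin; rewrite /W; case: insubP => // n' _ En; apply/eqP.
  by apply: contraTT ltin => /imax; rewrite -leqNgt /= En.
have ilt := ltn_ord i; pose j := i./2; have jk : (j < k)%N by rewrite /j; lia.
(* Past the last nonzero index [i], Taylor sums lose their higher terms: one term survives from
   [2 * j + 1], two from [2 * j]. *)
have taylor0 p m : (i <= p)%N -> taylor 1 W p m = W p.
  move=> ip; rewrite /taylor big_nat_recl // big1 ?addr0 => [|n _].
    by rewrite expr0 divr1 mul1r addn0.
  by rewrite Wgt ?mulr0 //; lia.
have taylor1 p m : (i <= p.+1)%N -> taylor 1 W p m.+1 = W p + W p.+1.
  move=> ip; rewrite /taylor !big_nat_recl // big1 ?addr0 => [|n _].
    by rewrite expr0 expr1 !divr1 !mul1r addn0 addn1.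
  by rewrite Wgt ?mulr0 //; lia.
have [ge_f le_f Eg] := par j jk.
have ij : (i <= (2 * j).+1)%N by rewrite /j; lia.
have m1 : (2 * k - 2 * j - 1 = (2 * k - 2 * j - 2).+1)%N by lia.
have [] := step j jk; rewrite m1 taylor0 // taylor1 //.
rewrite mul1r Eg; apply: block_eigenvalue_le1 => //.
(* [i] is one of the two indices of pair [j], so this pair is nonzero. *)
have Ei : (odd i + 2 * j = i)%N by rewrite /j; lia.
have : W (odd i + 2 * j)%N != 0 by rewrite Ei Wv.
by case: (odd i); rewrite ?add0n ?add1n => ->; rewrite ?orbT.
Qed.
End Amplification.
End Stability.

Theorem mainTheorem3 (R : realType) (k : nat) (alpha gamma : nat -> R)
    (alphaf : R)
    (hk : (2 <= k)%N)
    (halpha : forall j : nat, (1 <= j <= k - 1)%N -> 1 <= alpha j)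
    (halphak : alphaf <= alpha k)
    (halphaf : 1 / 2 <= alphaf)
    (hgamma : forall j : nat, (1 <= j <= k - 1)%N -> gamma j = alpha j - 1 / 2)
    (hgammak : gamma k = 1 / 2 - alphaf + alpha k) :
  genalpha_A_stable k alpha gamma alphaf.
Proof.
have k0 : (0 < k)%N by lia.
(* With 1 in place of [alphaf], [alpha - 1 / 2] is [1 / 2 - 1 + alpha], so both kinds of pairs obey
   the same conditions. *)
have par j : (j < k)%N -> let fj := alphaf_of R k alphaf j in
    [/\ 1 / 2 <= fj, fj <= alpha j.+1 & gamma j.+1 = 1 / 2 - fj + alpha j.+1].
  move=> jk; rewrite /alphaf_of; case: eqP => [->|njk] //=.
  have jk1 : (1 <= j.+1 <= k - 1)%N by lia.
  by split; [lra|exact: halpha|rewrite hgamma //; lra].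
move=> theta th0.
have ampG : is_amplification_matrix alpha gamma alphaf theta
    (amplification_mx R k alpha gamma alphaf theta).
  apply: amplification_mxP => // j jk; have [h1 h2 h3] := par j jk.
  (* The conditions force [alpha >= 1 / 2] and [gamma >= 1 / 2] in every pair. *)
  by apply: block_denominator_neq0 => //; lra.
exists (amplification_mx R k alpha gamma alphaf theta) => // l.
exact: amplification_eigenvalue_le1 par ampG.
Qed.
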